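(* Let $\alpha,\bar\alpha,a,\bar a,b,\bar b$ be nowhere vanishing functions and $u,v,\bar u,\bar v$ functions on $\mathbb{Z}^2$, and set $$f=\frac{u+v}{2},\quad \bar f=\frac{\bar u+\bar v}{2},\quad g=\frac{u-v}{2},\quad \bar g=\frac{\bar u-\bar v}{2},\quad T=ab+g^2,\quad \bar T=\bar a\bar b+\bar g^2 .$$ Then the compatibility condition $L_2M=M_1L$ of the discrete Gauss-Weingarten equations $F_1=LF$, $F_2=MF$ with $$L=\begin{pmatrix}0&1/\alpha&0&0\\ -\alpha&u&0&b\\ 0&0&0&1/\alpha\\ 0&a&-\alpha&v\end{pmatrix},\qquad M=\begin{pmatrix}0&0&1/\bar\alpha&0\\ 0&0&0&1/\bar\alpha\\ -\bar\alpha&0&\bar u&\bar b\\ 0&-\bar\alpha&\bar a&\bar v\end{pmatrix}$$ of a discrete asymptotic net is given by the discrete projective Gauss-Mainardi-Codazzi equations, i.e. $L_2M=M_1L$ holds if and only if $$\begin{aligned} \alpha_2&=w\alpha, & wf_2&=f-\frac{a}{\bar\alpha}\bar g, & wg_2&=-g+\frac{a}{\bar\alpha}\bar f, & wb_2&=-\frac{a}{\bar\alpha^2},\\ \bar\alpha_1&=w\bar\alpha, & w\bar f_1&=\bar f-\frac{\bar a}{\alpha}g, & w\bar g_1&=-\bar g+\frac{\bar a}{\alpha}f, & w\bar b_1&=-\frac{\bar a}{\alpha^2}, \end{aligned}$$ together with $$\bar a\,\bar\alpha\,\Delta_2T=a\,\alpha\,\Delta_1\bar T,$$ where $w$ is a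 function defined (up to sign at each point) by $$\alpha\bar\alpha(w^2-1)+a\bar a=0 .$$ The constraint $\alpha\bar\alpha_1=\bar\alpha\alpha_2$ is implied by the equations $\alpha_2=w\alpha$ and $\bar\alpha_1=w\bar\alpha$.
   Context: For a function (or matrix-valued function) $h$ on $\mathbb{Z}^2$ with variables $(n_1,n_2)$, subscripts $1,2$ denote the shifts $h_1(n_1,n_2)=h(n_1+1,n_2)$ and $h_2(n_1,n_2)=h(n_1,n_2+1)$, and $\Delta_ih=h_i-h$. Bars merely distinguish functions (no complex conjugation). The frame is $F=(r,r^1,r^2,r^{12})^T$, where $r$ denotes homogeneous coordinates of a discrete asymptotic net in $\mathbb{P}^3$ (a net with planar stars) and $r^1=\alpha r_1$, $r^2=\bar\alpha r_2$, $r^{12}=\alpha\bar\alpha_1r_{12}$; the compatibility condition is that of $F_{12}=F_{21}$. *)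

(* Defs.v *)
From HB Require Import structures.
From mathcomp Require Import all_boot all_order all_algebra.

Set Implicit Arguments.
Unset Strict Implicit.
Unset Printing Implicit Defensive.

Import Order.TTheory GRing.Theory Num.Theory.
Local Open Scope ring_scope.

Definition lattice_fun (X : Type) : Type := int -> int -> X.

Definition shift1 (X : Type) (h : lattice_fun X) : lattice_fun X :=
  fun n1 n2 => h (n1 + 1) n2.

Definition shift2 (X : Type) (h : lattice_fun X) : lattice_fun X :=
  fun n1 n2 => h n1 (n2 + 1).

Definition diff1 (V : zmodType) (h : lattice_fun V) : lattice_fun V :=
  fun n1 n2 => shift1 h n1 n2 - h n1 n2.

Definition diff2 (V : zmodType) (h : lattice_fun V) : lattice_fun V :=
  fun n1 n2 => shift2 h n1 n2 - h n1 n2.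

Section GaussWeingarten.

Variable K : fieldType.
Implicit Types al alB a aB b bB u v uB vB f fB g gB T TB w : lattice_fun K.

Definition mx4_of_rows (rows : seq (seq K)) : 'M[K]_4 :=
  \matrix_(i < 4, j < 4) nth 0 (nth [::] rows i) j.

(* A name ending in B stands for the barred symbol: alB is \bar\alpha, etc.
   gw_L and gw_M are the coefficient matrices of F_1 = L F and F_2 = M F for
   the frame F = (r, r^1, r^2, r^12), r^1 = al r_1, r^2 = alB r_2; since
   F_12 = L_2 M F and F_21 = M_1 L F, compatibility is L_2 M = M_1 L. *)

Definition gw_L al a b u v : lattice_fun 'M[K]_4 := fun n1 n2 =>
  mx4_of_rows
    [:: [:: 0;            1 / al n1 n2; 0;            0           ];
        [:: - al n1 n2;   u n1 n2;      0;            b n1 n2     ];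
        [:: 0;            0;            0;            1 / al n1 n2];
        [:: 0;            a n1 n2;      - al n1 n2;   v n1 n2     ]].

Definition gw_M alB aB bB uB vB : lattice_fun 'M[K]_4 := fun n1 n2 =>
  mx4_of_rows
    [:: [:: 0;            0;            1 / alB n1 n2; 0            ];
        [:: 0;            0;            0;             1 / alB n1 n2];
        [:: - alB n1 n2;  0;            uB n1 n2;      bB n1 n2     ];
        [:: 0;            - alB n1 n2;  aB n1 n2;      vB n1 n2     ]].

(* Pointwise condition defining w: it determines w n1 n2 only up to sign. *)
Definition w_eq al alB a aB (n1 n2 : int) (x : K) : Prop :=
  al n1 n2 * alB n1 n2 * (x ^+ 2 - 1) + a n1 n2 * aB n1 n2 = 0.

Definition gmc_dir2 al alB a b f fB g gB w : Prop := forall n1 n2 : int,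
  [/\ shift2 al n1 n2 = w n1 n2 * al n1 n2,
      w n1 n2 * shift2 f n1 n2 = f n1 n2 - a n1 n2 / alB n1 n2 * gB n1 n2,
      w n1 n2 * shift2 g n1 n2 = - g n1 n2 + a n1 n2 / alB n1 n2 * fB n1 n2
    & w n1 n2 * shift2 b n1 n2 = - (a n1 n2 / alB n1 n2 ^+ 2)].

Definition gmc_dir1 al alB aB bB f fB g gB w : Prop := forall n1 n2 : int,
  [/\ shift1 alB n1 n2 = w n1 n2 * alB n1 n2,
      w n1 n2 * shift1 fB n1 n2 = fB n1 n2 - aB n1 n2 / al n1 n2 * g n1 n2,
      w n1 n2 * shift1 gB n1 n2 = - gB n1 n2 + aB n1 n2 / al n1 n2 * f n1 n2
    & w n1 n2 * shift1 bB n1 n2 = - (aB n1 n2 / al n1 n2 ^+ 2)].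

Definition gmc_T al alB a aB T TB : Prop := forall n1 n2 : int,
  aB n1 n2 * alB n1 n2 * diff2 T n1 n2 = a n1 n2 * al n1 n2 * diff1 TB n1 n2.

End GaussWeingarten.

(* Main.v *)
Require Import Defs.
From HB Require Import structures.
From mathcomp Require Import all_boot all_order all_algebra.
From mathcomp Require Import ring.

Set Implicit Arguments.
Unset Strict Implicit.
Unset Printing Implicit Defensive.

Import Order.TTheory GRing.Theory Num.Theory.
Local Open Scope ring_scope.

(** Comparing [L_2 M] with [M_1 L] leaves eleven nontrivial scalar equations at
    each lattice point. The entries (1,4) and (4,1) both say
    [al alB_1 = alB al_2], so that the ratio [w = al_2 / al] is also
    [alB_1 / alB]: this is the function [w] of the statement, and it never
    vanishes. Once [al_2 = w al] and [alB_1 = w alB] are substituted, the other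
    entries read as follows.

    - The second and third rows are exchanged by the symmetry that swaps the
      two lattice directions together with barred and unbarred data. The second
      one gives [b_2], [u_2] and, from the entry (2,3), the equation
      [al alB (w^2 - 1) + a aB = 0] ([second_row_entriesE]); the third one gives
      [bB_1], [uB_1] and the same equation for [w].
    - The entries (4,2) and (4,3) are a linear system for the pair [v_2], [vB_1]
      with determinant [al alB - a aB] up to sign. The equation for [w] turns this
      determinant into [al alB w^2], so the system has exactly one solution
      ([fourth_row_systemE]).
    - The entry (4,4) is the only one that contains [a_2] and [aB_1]. By the
      equations already solved, the difference of its two sides is, up to a
      nonzero factor, the difference of the two sides of
      [aB alB Delta_2 T = a al Delta_1 TB] ([corner_entryE]).

    Half sums and half differences exchange the equations for [u_2], [v_2] with
    those for [f_2], [g_2] ([half_sum_diffE]). For fixed [w] every step is an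
    equivalence, so that both directions of the theorem come at once
    ([compat_pointwiseE]). *)

(** * Products of explicit matrices of order four *)

Section ExplicitMatrices.

Variable K : fieldType.
Implicit Types (r s : seq (seq K)) (A B : 'M[K]_4).

Lemma mx4P A B :
  A = B <-> forall i j : nat, (i < 4)%N -> (j < 4)%N ->
              A (inord i) (inord j) = B (inord i) (inord j).
Proof.
split=> [-> // | AB]; apply/matrixP => i j.
by move: (AB i j (ltn_ord i) (ltn_ord j)); rewrite !inord_val.
Qed.

Lemma mulmx4_of_rowsE r s (i j : nat) : (i < 4)%N -> (j < 4)%N ->
  (mx4_of_rows r *m mx4_of_rows s) (inord i) (inord j) =
  (nth [::] r i)`_0 * (nth [::] s 0)`_j + (nth [::] r i)`_1 * (nth [::] s 1)`_j +
  (nth [::] r i)`_2 * (nth [::] s 2)`_j + (nth [::] r i)`_3 * (nth [::] s 3)`_j.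
Proof.
move=> i4 j4; rewrite !mxE !big_ord_recl big_ord0 !mxE /= !inordK //.
by rewrite addr0 !addrA.
Qed.

End ExplicitMatrices.

(** * Scalar equations at one lattice point *)

Section ScalarEquations.

Variable K : numFieldType.
Implicit Types al alB a aB b bB u v uB vB w : K.

(** Clearing denominators multiplies the difference of the two sides of an
    equation by a nonzero factor; this turns such a rearrangement into a single
    identity for [field]. *)
Lemma eq_subr_scale (c x y x' y' : K) :
  c != 0 -> x - y = c * (x' - y') -> (x = y <-> x' = y').
Proof.
move=> c0 xyE; split=> [xy | xy]; apply/eqP; rewrite -subr_eq0.
  by move/eqP: xyE; rewrite xy subrr eq_sym mulf_eq0 (negPf c0).
by rewrite xyE xy subrr mulr0.
Qed.

(** The equation for [w] comes from the entry (2,3) after [b_2] is replaced by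
    its value. *)
Lemma second_row_entriesE al alB a aB b2 u2 v vB w :
    al != 0 -> alB != 0 -> w != 0 ->
  [/\ - (b2 * alB) = a / (w * alB),
      - (w * al / alB) + b2 * aB = - (al / (w * alB))
    & u2 / alB + b2 * vB = v / (w * alB)] <->
  [/\ al * alB * (w ^+ 2 - 1) + a * aB = 0,
      w * b2 = - (a / alB ^+ 2)
    & w * u2 = v + a / alB * vB].
Proof.
move=> al0 alB0 w0.
have b2E : - (b2 * alB) = a / (w * alB) <-> w * b2 = - (a / alB ^+ 2).
  apply: (@eq_subr_scale (- (alB / w))).
    by rewrite oppr_eq0 mulf_neq0 ?invr_eq0.
  by field; rewrite w0 alB0.
suff rest : w * b2 = - (a / alB ^+ 2) ->
    (- (w * al / alB) + b2 * aB = - (al / (w * alB)) <->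
     al * alB * (w ^+ 2 - 1) + a * aB = 0) /\
    (u2 / alB + b2 * vB = v / (w * alB) <-> w * u2 = v + a / alB * vB).
  split=> [[/b2E b2w e23 e24] | [we b2w u2w]]; have [weE u2E] := rest b2w.
    by split=> //; [apply/weE | apply/u2E].
  by split; [apply/b2E | apply/weE | apply/u2E].
move=> b2w.
have {b2w}-> : b2 = - (a / alB ^+ 2) / w by rewrite -b2w mulrC mulKf.
split.
  apply: (@eq_subr_scale (- (w * alB ^+ 2)^-1)).
    by rewrite oppr_eq0 invr_eq0 mulf_neq0 ?expf_neq0.
  by field; rewrite w0 alB0.
apply: (@eq_subr_scale (w * alB)^-1); first by rewrite invr_eq0 mulf_neq0.
by field; rewrite w0 alB0.
Qed.

(** Each unknown is isolated by eliminating the other one; the equation for [w]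
    then replaces [al alB - a aB] by [al alB w^2]. *)
Lemma fourth_row_systemE al alB a aB u v2 uB vB1 w :
    al != 0 -> alB != 0 -> w != 0 ->
    al * alB * (w ^+ 2 - 1) + a * aB = 0 ->
  (- (v2 * alB) = - (w * alB * u) + vB1 * a /\
   - (w * al * uB) + v2 * aB = - (vB1 * al)) <->
  (w * v2 = u - a / alB * uB /\ w * vB1 = uB - aB / al * u).
Proof.
move=> al0 alB0 w0 we; split=> -[e1 e2]; split; apply: subr0_eq.
- have -> : w * v2 - (u - a / alB * uB) =
      (v2 * (al * alB * (w ^+ 2 - 1) + a * aB)
       - al * (- (v2 * alB) - (- (w * alB * u) + vB1 * a))
       - a * (- (w * al * uB) + v2 * aB - - (vB1 * al))) / (w * al * alB).
    by field; rewrite w0 al0 alB0.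
  by rewrite we e1 e2 !subrr !mulr0 !subr0 mul0r.
- have -> : w * vB1 - (uB - aB / al * u) =
      (vB1 * (al * alB * (w ^+ 2 - 1) + a * aB)
       + aB * (- (v2 * alB) - (- (w * alB * u) + vB1 * a))
       + alB * (- (w * al * uB) + v2 * aB - - (vB1 * al))) / (w * al * alB).
    by field; rewrite w0 al0 alB0.
  by rewrite we e1 e2 !subrr !mulr0 !addr0 mul0r.
- have -> : - (v2 * alB) - (- (w * alB * u) + vB1 * a) =
      (u / al * (al * alB * (w ^+ 2 - 1) + a * aB)
       - alB * (w * v2 - (u - a / alB * uB))
       - a * (w * vB1 - (uB - aB / al * u))) / w.
    by field; rewrite w0 al0 alB0.
  by rewrite we e1 e2 !subrr !mulr0 !subr0 mul0r.
- have -> : - (w * al * uB) + v2 * aB - - (vB1 * al) =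
      (- (uB / alB) * (al * alB * (w ^+ 2 - 1) + a * aB)
       + aB * (w * v2 - (u - a / alB * uB))
       + al * (w * vB1 - (uB - aB / al * u))) / w.
    by field; rewrite w0 al0 alB0.
  by rewrite we e1 e2 !subrr !mulr0 !addr0 mul0r.
Qed.

(** The term [a_2] enters the entry (4,4) as [a_2 / alB] and the equation for
    [T], [TB] as [aB alB a_2 b_2 = - (a aB / w) (a_2 / alB)]; the term [aB_1]
    appears on the other side of both with the same factor. With this factor
    the two equations are proportional, the equation for [w] accounting for the
    remaining terms. *)
Lemma corner_entryE al alB a aB b bB u v uB vB a2 b2 u2 v2 aB1 bB1 uB1 vB1 w :
    al != 0 -> alB != 0 -> a != 0 -> aB != 0 -> w != 0 ->
    al * alB * (w ^+ 2 - 1) + a * aB = 0 ->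
    w * b2 = - (a / alB ^+ 2) -> w * bB1 = - (aB / al ^+ 2) ->
    w * u2 = v + a / alB * vB -> w * v2 = u - a / alB * uB ->
    w * uB1 = vB + aB / al * v -> w * vB1 = uB - aB / al * u ->
  (a2 / alB - w * al * bB + v2 * vB = - (w * alB * b) + aB1 / al + vB1 * v) <->
  (aB * alB *
     (a2 * b2 + ((u2 - v2) / 2) ^+ 2 - (a * b + ((u - v) / 2) ^+ 2)) =
   a * al *
     (aB1 * bB1 + ((uB1 - vB1) / 2) ^+ 2 - (aB * bB + ((uB - vB) / 2) ^+ 2))).
Proof.
move=> al0 alB0 a0 aB0 w0 we b2E bB1E u2E v2E uB1E vB1E.
have div_w (x y : K) : w * x = y -> x = y / w by move=> <-; rewrite mulrC mulKf.
move: b2E bB1E u2E v2E uB1E vB1E.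
do 6![move=> /div_w ->].
apply: iff_sym; apply: (@eq_subr_scale (- (a * aB / w))).
  by rewrite oppr_eq0 !mulf_neq0 ?invr_eq0.
(* The equation for [w] is linear in [aB]; eliminating [aB] rather than [w]
   leaves an identity between rational functions of independent variables. *)
have -> : aB = al * alB * (1 - w ^+ 2) / a.
  apply: (mulfI a0); rewrite mulrC [RHS]mulrC divfK // mulrC.
  by apply/eqP; rewrite -subr_eq0 -we; apply/eqP; ring.
by field; rewrite w0 al0 alB0 a0.
Qed.

Lemma half_sum_diffE (c u v uB vB u2 v2 w : K) :
  (w * ((u2 + v2) / 2) = (u + v) / 2 - c * ((uB - vB) / 2) /\
   w * ((u2 - v2) / 2) = - ((u - v) / 2) + c * ((uB + vB) / 2)) <->
  (w * u2 = v + c * vB /\ w * v2 = u - c * uB).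
Proof.
have two0 : (2 : K) != 0 by rewrite pnatr_eq0.
split=> -[e1 e2]; split.
- have -> : w * u2 = w * ((u2 + v2) / 2) + w * ((u2 - v2) / 2) by field.
  by rewrite e1 e2; field.
- have -> : w * v2 = w * ((u2 + v2) / 2) - w * ((u2 - v2) / 2) by field.
  by rewrite e1 e2; field.
- have -> : w * ((u2 + v2) / 2) = (w * u2 + w * v2) / 2 by field.
  by rewrite e1 e2; field.
- have -> : w * ((u2 - v2) / 2) = (w * u2 - w * v2) / 2 by field.
  by rewrite e1 e2; field.
Qed.

End ScalarEquations.

(** * The compatibility condition at one lattice point *)

Section Compatibility.

Variable K : numFieldType.
Variables (al alB a aB b bB u v uB vB : lattice_fun K) (n1 n2 : int).

Let L := gw_L al a b u v.
Let M := gw_M alB aB bB uB vB.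

Let half_sum (h k : lattice_fun K) : lattice_fun K :=
  fun n1 n2 => (h n1 n2 + k n1 n2) / 2.
Let half_diff (h k : lattice_fun K) : lattice_fun K :=
  fun n1 n2 => (h n1 n2 - k n1 n2) / 2.

Let f := half_sum u v.
Let fB := half_sum uB vB.
Let g := half_diff u v.
Let gB := half_diff uB vB.
Let T : lattice_fun K := fun n1 n2 => a n1 n2 * b n1 n2 + g n1 n2 ^+ 2.
Let TB : lattice_fun K := fun n1 n2 => aB n1 n2 * bB n1 n2 + gB n1 n2 ^+ 2.

(** The entries (1,4), (4,1), then the second row, the third row, and the rest
    of the fourth row; the third row is written with its two sides exchanged,
    to make it the mirror image of the second. *)
Lemma compat_entriesE :
  shift2 L n1 n2 *m M n1 n2 = shift1 M n1 n2 *m L n1 n2 <->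
  [/\ (shift2 al n1 n2)^-1 / alB n1 n2 = (shift1 alB n1 n2)^-1 / al n1 n2 /\
      shift2 al n1 n2 * alB n1 n2 = shift1 alB n1 n2 * al n1 n2,
      [/\ - (shift2 b n1 n2 * alB n1 n2) = a n1 n2 / shift1 alB n1 n2,
          - (shift2 al n1 n2 / alB n1 n2) + shift2 b n1 n2 * aB n1 n2
            = - (al n1 n2 / shift1 alB n1 n2)
        & shift2 u n1 n2 / alB n1 n2 + shift2 b n1 n2 * vB n1 n2
            = v n1 n2 / shift1 alB n1 n2],
      [/\ - (shift1 bB n1 n2 * al n1 n2) = aB n1 n2 / shift2 al n1 n2,
          - (shift1 alB n1 n2 / al n1 n2) + shift1 bB n1 n2 * a n1 n2
            = - (alB n1 n2 / shift2 al n1 n2)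
        & shift1 uB n1 n2 / al n1 n2 + shift1 bB n1 n2 * v n1 n2
            = vB n1 n2 / shift2 al n1 n2]
    & [/\ - (shift2 v n1 n2 * alB n1 n2)
            = - (shift1 alB n1 n2 * u n1 n2) + shift1 vB n1 n2 * a n1 n2,
          - (shift2 al n1 n2 * uB n1 n2) + shift2 v n1 n2 * aB n1 n2
            = - (shift1 vB n1 n2 * al n1 n2)
        & shift2 a n1 n2 / alB n1 n2 - shift2 al n1 n2 * bB n1 n2
            + shift2 v n1 n2 * vB n1 n2
          = - (shift1 alB n1 n2 * b n1 n2) + shift1 aB n1 n2 / al n1 n2
            + shift1 vB n1 n2 * v n1 n2]].
Proof.
have inv_mulC (x y : K) : x^-1 * y = y / x by rewrite mulrC.
pose simp := (mul0r, mulr0, add0r, addr0, div1r, mulNr, mulrN, mulr1, opprK).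
rewrite mx4P /L /M /shift1 /shift2; split=> [E | ].
  split; [split | split | split | split].
  - by move: (E 0 3 isT isT); rewrite !mulmx4_of_rowsE //= !simp.
  - by move: (E 3 0 isT isT); rewrite !mulmx4_of_rowsE //= !simp.
  - by move: (E 1 1 isT isT); rewrite !mulmx4_of_rowsE //= !simp inv_mulC.
  - by move: (E 1 2 isT isT); rewrite !mulmx4_of_rowsE //= !simp inv_mulC.
  - by move: (E 1 3 isT isT); rewrite !mulmx4_of_rowsE //= !simp inv_mulC.
  - by move: (E 2 2 isT isT); rewrite !mulmx4_of_rowsE //= !simp inv_mulC => /esym.
  - by move: (E 2 1 isT isT); rewrite !mulmx4_of_rowsE //= !simp inv_mulC => /esym.
  - by move: (E 2 3 isT isT); rewrite !mulmx4_of_rowsE //= !simp inv_mulC => /esym.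
  - by move: (E 3 1 isT isT); rewrite !mulmx4_of_rowsE //= !simp.
  - by move: (E 3 2 isT isT); rewrite !mulmx4_of_rowsE //= !simp.
  - by move: (E 3 3 isT isT); rewrite !mulmx4_of_rowsE //= !simp.
move=> [] [e14 e41] [e22 e23 e24] [e33 e32 e34] [e42 e43 e44] i j.
case: i => [|[|[|[|//]]]] _; case: j => [|[|[|[|//]]]] _;
  by rewrite !mulmx4_of_rowsE //= !simp // ?inv_mulC.
Qed.

(** The mirror symmetry of the system lets the same scalar lemma treat the
    second and the third row, and likewise the pairs [u], [v] and [uB], [vB]. *)
Lemma compat_pointwiseE (w : K) :
    al n1 n2 != 0 -> alB n1 n2 != 0 -> a n1 n2 != 0 -> aB n1 n2 != 0 ->
    w != 0 ->
    shift2 al n1 n2 = w * al n1 n2 -> shift1 alB n1 n2 = w * alB n1 n2 ->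
  shift2 L n1 n2 *m M n1 n2 = shift1 M n1 n2 *m L n1 n2 <->
  [/\ w_eq al alB a aB n1 n2 w,
      [/\ w * shift2 f n1 n2 = f n1 n2 - a n1 n2 / alB n1 n2 * gB n1 n2,
          w * shift2 g n1 n2 = - g n1 n2 + a n1 n2 / alB n1 n2 * fB n1 n2
        & w * shift2 b n1 n2 = - (a n1 n2 / alB n1 n2 ^+ 2)],
      [/\ w * shift1 fB n1 n2 = fB n1 n2 - aB n1 n2 / al n1 n2 * g n1 n2,
          w * shift1 gB n1 n2 = - gB n1 n2 + aB n1 n2 / al n1 n2 * f n1 n2
        & w * shift1 bB n1 n2 = - (aB n1 n2 / al n1 n2 ^+ 2)]
    & aB n1 n2 * alB n1 n2 * diff2 T n1 n2
      = a n1 n2 * al n1 n2 * diff1 TB n1 n2].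
Proof.
move=> al0 alB0 a0 aB0 w0 al2E alB1E; rewrite compat_entriesE al2E alB1E.
have fgE := half_sum_diffE (a n1 n2 / alB n1 n2) (u n1 n2) (v n1 n2)
  (uB n1 n2) (vB n1 n2) (shift2 u n1 n2) (shift2 v n1 n2) w.
have fgBE := half_sum_diffE (aB n1 n2 / al n1 n2) (uB n1 n2) (vB n1 n2)
  (u n1 n2) (v n1 n2) (shift1 uB n1 n2) (shift1 vB n1 n2) w.
have row2E := second_row_entriesE (a n1 n2) (aB n1 n2) (shift2 b n1 n2)
  (shift2 u n1 n2) (v n1 n2) (vB n1 n2) al0 alB0 w0.
have row3E := second_row_entriesE (aB n1 n2) (a n1 n2) (shift1 bB n1 n2)
  (shift1 uB n1 n2) (vB n1 n2) (v n1 n2) alB0 al0 w0.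
have weB : alB n1 n2 * al n1 n2 * (w ^+ 2 - 1) + aB n1 n2 * a n1 n2 =
    al n1 n2 * alB n1 n2 * (w ^+ 2 - 1) + a n1 n2 * aB n1 n2 by ring.
rewrite weB in row3E.
split.
  move=> [_ /row2E[we b2E u2E] /row3E[_ bB1E uB1E] [e42 e43 e44]].
  have [v2E vB1E] := (fourth_row_systemE _ _ _ _ al0 alB0 w0 we).1 (conj e42 e43).
  have [f2E g2E] := fgE.2 (conj u2E v2E).
  have [fB1E gB1E] := fgBE.2 (conj uB1E vB1E).
  split=> //.
  exact: (corner_entryE _ _ _ _ al0 alB0 a0 aB0 w0 we b2E bB1E u2E v2E uB1E vB1E).1.
move=> [we [f2E g2E b2E] [fB1E gB1E bB1E] TE].
have [u2E v2E] := fgE.1 (conj f2E g2E).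
have [uB1E vB1E] := fgBE.1 (conj fB1E gB1E).
have [e42 e43] := (fourth_row_systemE _ _ _ _ al0 alB0 w0 we).2 (conj v2E vB1E).
split; [| exact/row2E | exact/row3E | split=> //].
  by split; [rewrite !invfM -!mulrA [X in _ * X]mulrC | rewrite mulrAC].
exact: (corner_entryE _ _ _ _ al0 alB0 a0 aB0 w0 we b2E bB1E u2E v2E uB1E vB1E).2.
Qed.

End Compatibility.

Theorem theorem3p5 (K : numFieldType)
    (al alB a aB b bB u v uB vB : lattice_fun K)
    (al_neq0 : forall n1 n2 : int, al n1 n2 != 0)
    (alB_neq0 : forall n1 n2 : int, alB n1 n2 != 0)
    (a_neq0 : forall n1 n2 : int, a n1 n2 != 0)
    (aB_neq0 : forall n1 n2 : int, aB n1 n2 != 0)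
    (b_neq0 : forall n1 n2 : int, b n1 n2 != 0)
    (bB_neq0 : forall n1 n2 : int, bB n1 n2 != 0) :
  let f : lattice_fun K := fun n1 n2 => (u n1 n2 + v n1 n2) / 2 in
  let fB : lattice_fun K := fun n1 n2 => (uB n1 n2 + vB n1 n2) / 2 in
  let g : lattice_fun K := fun n1 n2 => (u n1 n2 - v n1 n2) / 2 in
  let gB : lattice_fun K := fun n1 n2 => (uB n1 n2 - vB n1 n2) / 2 in
  let T : lattice_fun K := fun n1 n2 => a n1 n2 * b n1 n2 + g n1 n2 ^+ 2 in
  let TB : lattice_fun K := fun n1 n2 => aB n1 n2 * bB n1 n2 + gB n1 n2 ^+ 2 in
  let L := gw_L al a b u v in
  let M := gw_M alB aB bB uB vB in
  [/\ (forall n1 n2 : int,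
         shift2 L n1 n2 *m M n1 n2 = shift1 M n1 n2 *m L n1 n2)
      <-> (exists w : lattice_fun K,
             [/\ forall n1 n2 : int, w_eq al alB a aB n1 n2 (w n1 n2),
                 gmc_dir2 al alB a b f fB g gB w,
                 gmc_dir1 al alB aB bB f fB g gB w
               & gmc_T al alB a aB T TB]),
      (forall (n1 n2 : int) (x y : K), w_eq al alB a aB n1 n2 x ->
         (w_eq al alB a aB n1 n2 y <-> y = x \/ y = - x))
    & (forall w : lattice_fun K,
         (forall n1 n2 : int, shift2 al n1 n2 = w n1 n2 * al n1 n2) ->
         (forall n1 n2 : int, shift1 alB n1 n2 = w n1 n2 * alB n1 n2) ->
         forall n1 n2 : int,
           al n1 n2 * shift1 alB n1 n2 = alB n1 n2 * shift2 al n1 n2)].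
Proof.
move=> f fB g gB T TB L M; split.
- split=> [compat | [w [we dir2 dir1 TE]] n1 n2].
    pose w : lattice_fun K := fun n1 n2 => shift2 al n1 n2 / al n1 n2.
    have w0 n1 n2 : w n1 n2 != 0 by rewrite mulf_neq0 ?invr_eq0 // al_neq0.
    have al2E n1 n2 : shift2 al n1 n2 = w n1 n2 * al n1 n2 by rewrite divfK.
    have alB1E n1 n2 : shift1 alB n1 n2 = w n1 n2 * alB n1 n2.
      have [[_ e41] _ _ _] := (compat_entriesE _ _ _ _ _ _ _ _ _ _ _ _).1 (compat n1 n2).
      by rewrite /w mulrAC e41 mulfK.
    have pointwise n1 n2 := (compat_pointwiseE b bB u v uB vB (al_neq0 n1 n2)
      (alB_neq0 n1 n2) (a_neq0 n1 n2) (aB_neq0 n1 n2) (w0 n1 n2)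
      (al2E n1 n2) (alB1E n1 n2)).1 (compat n1 n2).
    by exists w; split=> n1 n2; have [we [? ? ?] [? ? ?] TE] := pointwise n1 n2.
  have [al2E f2E g2E b2E] := dir2 n1 n2.
  have [alB1E fB1E gB1E bB1E] := dir1 n1 n2.
  (* [al] does not vanish at the shifted point [(n1, n2 + 1)] either. *)
  have w0 : w n1 n2 != 0.
    by apply: contra_neq (al_neq0 n1 (n2 + 1)) => w0; rewrite [LHS]al2E w0 mul0r.
  apply/(compat_pointwiseE b bB u v uB vB (al_neq0 n1 n2) (alB_neq0 n1 n2)
    (a_neq0 n1 n2) (aB_neq0 n1 n2) w0 al2E alB1E).
  by split.
- move=> n1 n2 x y wx.
  have alalB0 : al n1 n2 * alB n1 n2 != 0 by rewrite mulf_neq0.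
  have -> : w_eq al alB a aB n1 n2 y <-> y ^+ 2 = x ^+ 2.
    rewrite /w_eq -wx; apply: (@eq_subr_scale _ _ _ _ _ _ alalB0); ring.
  split=> [/eqP | [->|->]]; last by rewrite sqrrN.
    by rewrite eqf_sqr => /orP[] /eqP; [left | right].
  by [].
- by move=> w al2E alB1E n1 n2; rewrite al2E alB1E; ring.
Qed.
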